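(* Let $A\in\mathbb{C}^{m\times n}$, $W\in\mathbb{C}^{n\times m}$ with $\mathrm{ind}(WA)=k$. If $A(WA)^k[(WA)^k]^{\dagger}=UV$ is a full-rank decomposition of $A(WA)^k[(WA)^k]^{\dagger}$, then the $W$-weighted core-EP inverse of $A$ possesses the following representation: $$A^{\mathrm{cEP},W}=U(VWAWU)^{-1}V.$$
   Context: For a square complex matrix $B$, $\mathrm{ind}(B)$ is the smallest non-negative integer $j$ with $\mathrm{rank}(B^j)=\mathrm{rank}(B^{j+1})$ (with $B^0=I$). $B^{\dagger}$ and $\mathcal{R}(B)$ denote the Moore-Penrose inverse and range (column space) of $B$. For $A\in\mathbb{C}^{m\times n}$, $W\in\mathbb{C}^{n\times m}$ and $p=\max\{\mathrm{ind}(AW),\mathrm{ind}(WA)\}$, the $W$-weighted core-EP inverse $A^{\mathrm{cEP},W}$ is the unique $Y\in\mathbb{C}^{m\times n}$ with $WAWY=(WA)^p[(WA)^p]^{\dagger}$ and $\mathcal{R}(Y)\subseteq\mathcal{R}((AW)^p)$. A full-rank decomposition of a matrix $G\in\mathbb{C}^{m\times n}$ of rank $s$ is a factorization $G=UV$ with $U\in\mathbb{C}^{m\times s}$ and $V\in\mathbb{C}^{s\times n}$, both of rank $s$. *)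

(* Defs.v *)
From mathcomp Require Import all_boot all_order all_algebra.

Set Implicit Arguments.
Unset Strict Implicit.
Unset Printing Implicit Defensive.

Import GRing.Theory Num.Theory.
Local Open Scope ring_scope.
Local Open Scope sesquilinear_scope.

Lemma mxindex_exists (F : fieldType) n (B : 'M[F]_n) :
  exists j, \rank (B ^+ j) == \rank (B ^+ j.+1).
Proof.
suff /existsP[j Pj] : [exists j : 'I_n.+1, \rank (B ^+ j) == \rank (B ^+ j.+1)].
  by exists j.
apply: contraT; rewrite negb_exists => /forallP Bneq.
have decr j : (j <= n.+1)%N -> (\rank (B ^+ j) + j <= n)%N.
  elim: j => [|j IHj] ltjn; first by rewrite addn0 rank_leq_row.
  rewrite addnS; apply: leq_trans (IHj (ltnW ltjn)); rewrite ltn_add2r ltn_neqAle.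
  by rewrite eq_sym (Bneq (Ordinal ltjn)) exprS mxrankM_maxr.
by have := decr n.+1 (leqnn _); rewrite addnS ltnNge leq_addl.
Qed.

(* ind(B), with B ^+ 0 = 1%:M. *)
Definition mxindex (F : fieldType) n (B : 'M[F]_n) : nat :=
  ex_minn (mxindex_exists B).

(* Inclusion of ranges: %MS compares row spaces, hence the transpositions. *)
Definition colsubmx (F : fieldType) m n1 n2
    (Y : 'M[F]_(m, n1)) (B : 'M[F]_(m, n2)) : bool :=
  (Y^T <= B^T)%MS.

Lemma colsubmxP (F : fieldType) m n1 n2
    (Y : 'M[F]_(m, n1)) (B : 'M[F]_(m, n2)) :
  reflect (exists Z, Y = B *m Z) (colsubmx Y B).
Proof.
apply: (iffP submxP) => [[Z /(congr1 trmx)]|[Z ->]].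
  by rewrite trmx_mul !trmxK => ->; exists Z^T.
by exists Z^T; rewrite trmx_mul.
Qed.

Section IndexTheory.
Variables (F : fieldType) (n : nat) (B : 'M[F]_n).

Lemma mxrank_mxindex : \rank (B ^+ mxindex B) = \rank (B ^+ (mxindex B).+1).
Proof. by rewrite /mxindex; case: ex_minnP => j /eqP. Qed.

Lemma mxindex_min j : \rank (B ^+ j) = \rank (B ^+ j.+1) -> (mxindex B <= j)%N.
Proof. by rewrite /mxindex; case: ex_minnP => i _ min_i /eqP/min_i. Qed.

Lemma expr_mxindexr p q : (mxindex B <= p)%N ->
  exists T, B ^+ p = B ^+ (p + q) *m T.
Proof.
move=> lip; elim: q => [|q [T defBp]].
  by exists 1%:M; rewrite addn0 mulmx1.
have /colsubmxP[S defS] : colsubmx (B ^+ mxindex B) (B ^+ (mxindex B).+1).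
  have sub : colsubmx (B ^+ (mxindex B).+1) (B ^+ mxindex B).
    by apply/colsubmxP; exists B; rewrite exprSr.
  by rewrite /colsubmx -(geq_leqif (mxrank_leqif_sup sub)) !mxrank_tr mxrank_mxindex.
exists (S *m T); rewrite mulmxA {1}defBp; congr (_ *m T).
have lipq : (mxindex B <= p + q)%N by apply: leq_trans lip (leq_addr _ _).
rewrite -{1}(subnK lipq) exprD defS -!mulmxE mulmxA mulmxE -exprD.
by rewrite !addnS subnK.
Qed.

Lemma expr_mxindexl p q : (mxindex B <= p)%N ->
  exists T, B ^+ p = T *m B ^+ (p + q).
Proof.
move=> lip; elim: q => [|q [T defBp]].
  by exists 1%:M; rewrite addn0 mul1mx.
have /submxP[S defS] : (B ^+ mxindex B <= B ^+ (mxindex B).+1)%MS.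
  have sub : (B ^+ (mxindex B).+1 <= B ^+ mxindex B)%MS.
    by rewrite exprS submxMl.
  by rewrite -(geq_leqif (mxrank_leqif_sup sub)) mxrank_mxindex.
exists (T *m S); rewrite -mulmxA {1}defBp; congr (T *m _).
have lipq : (mxindex B <= p + q)%N by apply: leq_trans lip (leq_addr _ _).
rewrite -{1}(subnKC lipq) exprD defS -!mulmxE -mulmxA mulmxE -exprD.
by rewrite addSn subnKC // addnS.
Qed.

End IndexTheory.

(* The four Penrose equations; B^t* is the conjugate transpose of B. *)
Definition penrose (C : numClosedFieldType) m n
    (B : 'M[C]_(m, n)) (X : 'M[C]_(n, m)) : bool :=
  [&& B *m X *m B == B, X *m B *m X == X,
      (B *m X)^t* == B *m X & (X *m B)^t* == X *m B].

Section MoorePenroseTheory.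
Variable C : numClosedFieldType.

Lemma trmxC_mul m n p (A : 'M[C]_(m, n)) (B : 'M[C]_(n, p)) :
  (A *m B)^t* = B^t* *m A^t*.
Proof. by rewrite trmx_mul map_mxM. Qed.

Lemma mulmx_trmxC_eq0 m n (A : 'M[C]_(m, n)) : A *m A^t* = 0 -> A = 0.
Proof.
move=> AA0; apply/matrixP => i j; rewrite !mxE.
have /eqP := congr1 (fun M : 'M_m => M i i) AA0; rewrite !mxE.
rewrite psumr_eq0 => [/allP/(_ j (mem_index_enum j))|k _].
  by rewrite !mxE mul_conjC_eq0 => /eqP.
by rewrite !mxE mul_conjC_ge0.
Qed.

Lemma unitmx_mul_trmxC m n (A : 'M[C]_(m, n)) :
  row_free A -> A *m A^t* \in unitmx.
Proof.
move=> Afree; rewrite -row_free_unit -kermx_eq0.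
set K := kermx _; have : K *m (A *m A^t*) = 0 by apply: mulmx_ker.
move=> KAA; rewrite -(mulmx_free_eq0 _ Afree); apply/eqP/mulmx_trmxC_eq0.
by rewrite trmxC_mul mulmxA -(mulmxA K) KAA mul0mx.
Qed.

Lemma mpinv_exists m n (B : 'M[C]_(m, n)) : exists X, penrose B X.
Proof.
have [r [L [R [defB fullL freeR]]]] : exists r (L : 'M[C]_(m, r)) (R : 'M_(r, n)),
    [/\ B = L *m R, row_full L & row_free R].
  exists (\rank B), (col_base B), (row_base B).
  by rewrite mulmx_base col_base_full row_base_free.
have uR : R *m R^t* \in unitmx by apply: unitmx_mul_trmxC.
have uL : L^t* *m L \in unitmx.
  rewrite -{2}(trmxCK L); apply: unitmx_mul_trmxC.
  by rewrite /row_free mxrank_map mxrank_tr.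
pose iR := R^t* *m invmx (R *m R^t*); pose iL := invmx (L^t* *m L) *m L^t*.
have RK : R *m iR = 1%:M by rewrite mulmxA mulmxV.
have LK : iL *m L = 1%:M by rewrite -mulmxA mulVmx.
have hR : (iR *m R)^t* = iR *m R.
  rewrite /iR !trmxC_mul trmxCK trmx_inv map_invmx trmxC_mul trmxCK.
  by rewrite mulmxA.
have hL : (L *m iL)^t* = L *m iL.
  rewrite /iL !trmxC_mul trmxCK trmx_inv map_invmx trmxC_mul trmxCK.
  by rewrite mulmxA.
have BX : B *m (iR *m iL) = L *m iL.
  by rewrite defB mulmxA -(mulmxA L) RK mulmx1.
have XB : (iR *m iL) *m B = iR *m R.
  by rewrite defB mulmxA -(mulmxA iR) LK mulmx1.
exists (iR *m iL); rewrite /penrose BX XB hR hL !eqxx !andbT; apply/andP; split.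
  by rewrite {1}defB mulmxA -(mulmxA L) LK mulmx1 -defB.
by rewrite mulmxA -(mulmxA iR) RK mulmx1.
Qed.

Lemma penrose_uniq m n (B : 'M[C]_(m, n)) X Y :
  penrose B X -> penrose B Y -> X = Y.
Proof.
move=> /and4P[/eqP X1 /eqP X2 /eqP X3 /eqP X4].
move=> /and4P[/eqP Y1 /eqP Y2 /eqP Y3 /eqP Y4].
have BXY : B *m X = B *m Y.
  by rewrite -X3 -{1}Y1 -(mulmxA (B *m Y)) trmxC_mul X3 Y3 mulmxA X1.
have XBY : X *m B = Y *m B.
  by rewrite -X4 -{1}Y1 -mulmxA mulmxA trmxC_mul X4 Y4 -mulmxA (mulmxA B) X1.
by rewrite -X2 XBY -mulmxA BXY mulmxA Y2.
Qed.

End MoorePenroseTheory.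

(* Pinned down by mpinvP and penrose_uniq, whatever the choice operator returns. *)
Definition mpinv (C : numClosedFieldType) m n (B : 'M[C]_(m, n)) :
  'M[C]_(n, m) := xchoose (mpinv_exists B).

Lemma mpinvP (C : numClosedFieldType) m n (B : 'M[C]_(m, n)) :
  penrose B (mpinv B).
Proof. exact: (xchooseP (mpinv_exists B)). Qed.

Definition wcepinv_spec (C : numClosedFieldType) m n
    (A : 'M[C]_(m, n)) (W : 'M[C]_(n, m)) (Y : 'M[C]_(m, n)) : bool :=
  let p := maxn (mxindex (A *m W)) (mxindex (W *m A)) in
  (W *m A *m W *m Y == (W *m A) ^+ p *m mpinv ((W *m A) ^+ p))
  && colsubmx Y ((A *m W) ^+ p).

Section WeightedCoreEPTheory.
Variables (C : numClosedFieldType) (m n : nat).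
Variables (A : 'M[C]_(m, n)) (W : 'M[C]_(n, m)).

Lemma mulmx_expr_swap q : W *m (A *m W) ^+ q = (W *m A) ^+ q *m W.
Proof.
elim: q => [|q IHq]; first by rewrite !expr0 mulmx1 mul1mx.
by rewrite !exprSr -!mulmxE mulmxA IHq !mulmxA.
Qed.

Lemma wcepinv_exists : exists Y, wcepinv_spec A W Y.
Proof.
rewrite /wcepinv_spec; set p := maxn _ _.
have [T defT] := expr_mxindexr 2 (leq_maxr _ _ : (mxindex (W *m A) <= p)%N).
exists ((A *m W) ^+ p *m (A *m (T *m mpinv ((W *m A) ^+ p)))).
apply/andP; split; last by apply/colsubmxP; eexists.
apply/eqP; rewrite {2}defT !mulmxA; congr (_ *m T *m _).
rewrite -(mulmxA (W *m A)) mulmx_expr_swap !mulmxA -(mulmxA _ W).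
by rewrite !mulmxE -exprS -exprSr addn2.
Qed.

Lemma wcepinv_uniq Y Z : wcepinv_spec A W Y -> wcepinv_spec A W Z -> Y = Z.
Proof.
rewrite /wcepinv_spec; set p := maxn _ _.
move=> /andP[/eqP eqY /colsubmxP[Y' defY]] /andP[/eqP eqZ /colsubmxP[Z' defZ]].
apply/eqP; rewrite -subr_eq0 defY defZ -mulmxBr; apply/eqP.
have [T ->] := expr_mxindexl 2 (leq_maxl _ _ : (mxindex (A *m W) <= p)%N).
have -> : (A *m W) ^+ (p + 2) = A *m (W *m A *m W) *m (A *m W) ^+ p.
  by rewrite addn2 !exprS -!mulmxE !mulmxA.
have -> : T *m (A *m (W *m A *m W) *m (A *m W) ^+ p) *m (Y' - Z') =
    T *m A *m (W *m A *m W *m Y - W *m A *m W *m Z).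
  by rewrite defY defZ -mulmxBr -mulmxBr !mulmxA.
by rewrite eqY eqZ subrr mulmx0.
Qed.

End WeightedCoreEPTheory.

(* Pinned down by wcepinvP and wcepinv_uniq. *)
Definition wcepinv (C : numClosedFieldType) m n
    (A : 'M[C]_(m, n)) (W : 'M[C]_(n, m)) : 'M[C]_(m, n) :=
  xchoose (wcepinv_exists A W).

Lemma wcepinvP (C : numClosedFieldType) m n
    (A : 'M[C]_(m, n)) (W : 'M[C]_(n, m)) : wcepinv_spec A W (wcepinv A W).
Proof. exact: (xchooseP (wcepinv_exists A W)). Qed.

(* \rank U = s and \rank V = s already force \rank G = s; it is kept because
   the size s is by definition the rank of G. *)
Definition full_rank_decomp (F : fieldType) m n s
    (G : 'M[F]_(m, n)) (U : 'M[F]_(m, s)) (V : 'M[F]_(s, n)) : Prop :=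
  [/\ \rank G = s, G = U *m V, \rank U = s & \rank V = s].

(* Main.v *)
Require Import Defs.
From mathcomp Require Import all_boot all_order all_algebra.
From mathcomp Require Import reals complex.

(** Let [B = W A], of index [k], let [P = B^k (B^k)^+] and let [Y] be the weighted
    core-EP inverse of [A]; [p] is the larger of the indices of [A W] and [B], and
    [P] is the orthogonal projector onto the range of [B^k].  The powers of [B]
    have the same range from exponent [k] on, and an orthogonal
    projector depends only on its range ([mulmx_mpinv_eq]), so the defining
    equation of [Y] may be read as [W A W Y = P]
    ([expr_mpinv_stable]).  Likewise the range of [Y], which lies in that of
    [(A W)^p] and hence in that of [(A W)^(p+1) = A B^p W], lies in the range of
    [A P = U V] ([colsubmx_wcepinv]); thus [Y = U Z] for some [Z].

    Since [P] is idempotent, [U V P = U V], and cancelling [U] gives [V P = V].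
    Multiplying [W A W U Z = P] by [V] on the left therefore yields
    [(V W A W U) Z = V].  As [V] has a right inverse, so does the square matrix
    [V W A W U]; it is invertible, [Z] is its inverse times [V], and [Y = U Z] is
    the announced formula. *)

Set Implicit Arguments.
Unset Strict Implicit.
Unset Printing Implicit Defensive.

Import GRing.Theory Num.Theory.
Local Open Scope ring_scope.
Local Open Scope sesquilinear_scope.

Lemma mulmx_mpinvK (C : numClosedFieldType) m n (B : 'M[C]_(m, n)) :
  B *m mpinv B *m B = B.
Proof. by have /and4P[/eqP] := mpinvP B. Qed.

Lemma mulmx_mpinv_herm (C : numClosedFieldType) m n (B : 'M[C]_(m, n)) :
  (B *m mpinv B)^t* = B *m mpinv B.
Proof. by have /and4P[_ _ /eqP] := mpinvP B. Qed.

Lemma mulmx_mpinv_id (C : numClosedFieldType) m n n' (B : 'M[C]_(m, n))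
    (D : 'M[C]_(m, n')) :
  colsubmx D B -> B *m mpinv B *m D = D.
Proof. by case/colsubmxP=> T ->; rewrite mulmxA mulmx_mpinvK. Qed.

(** With equal ranges, each of the two projectors fixes the range of the other,
    so [Q P = P] and [P Q = Q]; taking adjoints in the first gives [P Q = P]. *)
Lemma mulmx_mpinv_eq (C : numClosedFieldType) m n n'
    (B : 'M[C]_(m, n)) (D : 'M[C]_(m, n')) :
  colsubmx B D -> colsubmx D B -> B *m mpinv B = D *m mpinv D.
Proof.
move=> sBD sDB.
have DB : D *m mpinv D *m (B *m mpinv B) = B *m mpinv B.
  by rewrite mulmxA mulmx_mpinv_id.
have BD : B *m mpinv B *m (D *m mpinv D) = D *m mpinv D.
  by rewrite mulmxA mulmx_mpinv_id.
by rewrite -mulmx_mpinv_herm -{1}DB trmxC_mul !mulmx_mpinv_herm.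
Qed.

Lemma expr_mpinv_stable (C : numClosedFieldType) n (B : 'M[C]_n) p :
  (mxindex B <= p)%N ->
  B ^+ p *m mpinv (B ^+ p) = B ^+ mxindex B *m mpinv (B ^+ mxindex B).
Proof.
move=> le_ip; apply: mulmx_mpinv_eq; apply/colsubmxP.
  by exists (B ^+ (p - mxindex B)); rewrite mulmxE -exprD subnKC.
have [T] := expr_mxindexr (p - mxindex B) (leqnn (mxindex B)).
by rewrite subnKC //; exists T.
Qed.

Lemma mulmx_expr_shift (F : fieldType) m n (A : 'M[F]_(m, n))
    (W : 'M[F]_(n, m)) q :
  (A *m W) ^+ q.+1 = A *m (W *m A) ^+ q *m W.
Proof.
elim: q => [|q IHq]; first by rewrite expr1 expr0 mulmx1.
by rewrite exprS IHq [in RHS]exprS -!mulmxE !mulmxA.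
Qed.

Lemma wcepinv_eq (C : numClosedFieldType) m n (A : 'M[C]_(m, n))
    (W : 'M[C]_(n, m)) (k := mxindex (W *m A)) :
  W *m A *m W *m wcepinv A W = (W *m A) ^+ k *m mpinv ((W *m A) ^+ k).
Proof.
have /andP[/eqP-> _] := wcepinvP A W.
by apply: expr_mpinv_stable; rewrite leq_maxr.
Qed.

Lemma colsubmx_wcepinv (C : numClosedFieldType) m n (A : 'M[C]_(m, n))
    (W : 'M[C]_(n, m)) (k := mxindex (W *m A)) :
  colsubmx (wcepinv A W) (A *m (W *m A) ^+ k *m mpinv ((W *m A) ^+ k)).
Proof.
have /andP[_ /colsubmxP[Z ->]] := wcepinvP A W; set p := maxn _ _.
(* The shift identity turns [(A W)^q] into [A (W A)^(q-1) W], and the exponent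
   [q - 1] must be at least [k]: hence one power more than [p]. *)
have [T ->] := expr_mxindexr 1 (leq_maxl _ _ : (mxindex (A *m W) <= p)%N).
have le_kp : (k <= p)%N by rewrite leq_maxr.
have PBp : (W *m A) ^+ k *m mpinv ((W *m A) ^+ k) *m (W *m A) ^+ p =
    (W *m A) ^+ p.
  apply: mulmx_mpinv_id; apply/colsubmxP; exists ((W *m A) ^+ (p - k)).
  by rewrite mulmxE -exprD subnKC.
apply/colsubmxP; exists ((W *m A) ^+ p *m W *m T *m Z).
by rewrite addn1 mulmx_expr_shift -{1}PBp !mulmxA.
Qed.

(* R[i], for R the real numbers, is the field of complex numbers. *)
Theorem corollary2p7 (R : realType) (m n k s : nat)
    (A : 'M[R[i]]_(m, n)) (W : 'M[R[i]]_(n, m))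
    (U : 'M[R[i]]_(m, s)) (V : 'M[R[i]]_(s, n))
    (hk : mxindex (W *m A) = k)
    (hUV : full_rank_decomp
             (A *m (W *m A) ^+ k *m mpinv ((W *m A) ^+ k)) U V) :
  V *m W *m A *m W *m U \in unitmx /\
  wcepinv A W = U *m invmx (V *m W *m A *m W *m U) *m V.
Proof.
case: hUV => _ defUV /eqP U_full /eqP/row_freeP[V' VK].
have := wcepinv_eq A W; have := colsubmx_wcepinv A W.
rewrite /= hk defUV => /colsubmxP[Z' ->]; rewrite -(mulmxA U V Z').
move: (V *m Z') => Z eqP_Z; set P := _ ^+ k *m _ in eqP_Z.
have VP : V *m P = V.
  apply: (row_full_inj U_full); rewrite mulmxA -defUV /P -!mulmxA.
  by congr (_ *m _); rewrite !mulmxA mulmx_mpinvK.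
have eqZ : V *m W *m A *m W *m U *m Z = V.
  by rewrite -[RHS]VP -eqP_Z !mulmxA.
have unitN : V *m W *m A *m W *m U \in unitmx.
  by apply: (mulmx1_unit (B := Z *m V') _).1; rewrite mulmxA eqZ.
by split=> //; rewrite -mulmxA -[X in invmx _ *m X]eqZ mulKmx.
Qed.
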